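(* Let $G$ be a $k$-regular bipartite graph of order $m$, and let $H$ be a $2t$-regular graph of order $n$ that admits a neighborhood balanced coloring and that admits a local distance antimagic labeling. Then $\chi_{ld}((G+K_1)[H])\leq 3\,\chi_{ld}(H)$.
   Context: Graphs are finite, simple and undirected; $G$ and $H$ have no isolated vertices. For a graph $G$ of order $n$ and a bijection $f\colon V(G)\to\{1,2,\dots,n\}$, the weight of a vertex $u$ is $w_f(u)=\sum_{x\in N(u)}f(x)$, where $N(u)$ is the open neighborhood of $u$. The bijection $f$ is a local distance antimagic labeling of $G$ if $w_f(u)\neq w_f(v)$ for every edge $uv$ of $G$. The local distance antimagic chromatic number $\chi_{ld}(G)$ is the minimum number of distinct weights over all local distance antimagic labelings of $G$ (an upper bound on $\chi_{ld}$ includes the assertion that such a labeling exists). A neighborhood balanced coloring of a graph is an assignment of one of two colors to each vertex (not necessarily proper) such that every vertex has equally many neighbors of each color. $G+K_1$ is the join of $G$ with a single vertex (a new vertex adjacent to all vertices of $G$). The lexicographic product (composition) $G[H]$ has vertex set $V(G)\times V(H)$, with $(g,h)$ and $(g',h')$ adjacent iff either $gg'\in E(G)$, or $g=g'$ and $hh'\in E(H)$. *)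

(* Defs.v *)
From mathcomp Require Import all_boot.

Set Implicit Arguments.
Unset Strict Implicit.
Unset Printing Implicit Defensive.

Structure sgraph := SGraph {
  vertex :> finType;
  edge : rel vertex;
  edge_sym : symmetric edge;
  edge_irr : irreflexive edge }.

Section Basic.
Variable G : sgraph.

Definition nbhd (u : G) : {set G} := [set v | edge u v].

Definition regular (k : nat) : Prop := forall u : G, #|nbhd u| = k.

Definition no_isolated : Prop := forall u : G, exists v : G, edge u v.

Definition bipartite : Prop :=
  exists A : {set G}, forall u v : G, edge u v -> (u \in A) != (v \in A).

Definition neighborhood_balanced (c : G -> bool) : Prop :=
  forall v : G,
    #|[set u in nbhd v | c u]| = #|[set u in nbhd v | ~~ c u]|.

Definition admits_nbc : Prop := exists c : G -> bool, neighborhood_balanced c.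

(** A labeling by {1, ..., n}, n = #|G|, is encoded by [f : G -> 'I_n];
    the label of [u] is [(f u).+1]. *)
Definition labeling := {ffun G -> 'I_#|G|}.

Definition label (f : labeling) (u : G) : nat := (f u).+1.

Definition is_bij (f : labeling) : bool :=
  injectiveb f && [forall i, i \in codom f].

Definition weight (f : labeling) (u : G) : nat := \sum_(x in nbhd u) label f x.

Definition is_ld_antimagic (f : labeling) : bool :=
  is_bij f && [forall u, forall v, edge u v ==> (weight f u != weight f v)].

Definition admits_ld_antimagic : Prop := exists f : labeling, is_ld_antimagic f.

Definition num_weights (f : labeling) : nat := size (undup (codom (weight f))).

(** The minimum of [num_weights] over all local distance antimagic labelings.
    The value 0 is a dummy when there is none: a bound on [chi_ld] must be
    stated together with [admits_ld_antimagic]. *)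
Definition chi_ld : nat :=
  if [pick f | is_ld_antimagic f] is Some f0
  then num_weights [arg min_(f < f0 | is_ld_antimagic f) num_weights f]
  else 0.

Lemma chi_ldP : admits_ld_antimagic ->
  (exists2 f, is_ld_antimagic f & num_weights f = chi_ld) /\
  (forall f, is_ld_antimagic f -> chi_ld <= num_weights f).
Proof.
case=> f1 Hf1; rewrite /chi_ld; case: pickP => [f0 Hf0 | /(_ f1)]; last by rewrite Hf1.
by case: arg_minnP => // f Hf min_f; split=> //; exists f.
Qed.

End Basic.

Definition K1_edge : rel unit := fun _ _ => false.
Lemma K1_sym : symmetric K1_edge. Proof. by []. Qed.
Lemma K1_irr : irreflexive K1_edge. Proof. by []. Qed.
Definition K1 : sgraph := SGraph K1_sym K1_irr.

Section Operations.
Variables G H : sgraph.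

Definition join_edge : rel (G + H) := fun x y =>
  match x, y with
  | inl a, inl b => edge a b
  | inr a, inr b => edge a b
  | _, _ => true
  end.
Lemma join_sym : symmetric join_edge.
Proof. by case=> a [b|b] //=; rewrite edge_sym. Qed.
Lemma join_irr : irreflexive join_edge.
Proof. by case=> a /=; rewrite edge_irr. Qed.
Definition join : sgraph := SGraph join_sym join_irr.

Definition lex_edge : rel (G * H) := fun x y =>
  edge x.1 y.1 || (x.1 == y.1) && edge x.2 y.2.
Lemma lex_sym : symmetric lex_edge.
Proof. by move=> x y; rewrite /lex_edge edge_sym eq_sym (edge_sym x.2). Qed.
Lemma lex_irr : irreflexive lex_edge.
Proof. by move=> x; rewrite /lex_edge !edge_irr andbF. Qed.
Definition lexprod : sgraph := SGraph lex_sym lex_irr.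

End Operations.

(* Main.v *)
(** Cut the labels into three consecutive blocks: first the copy of H over the
    apex, then the copies over one part A of G, then those over the other part;
    both parts have p = m/2 vertices. Inside a block of width q, the i-th
    copy gets, at a vertex h with label f(h) in an optimal labeling f of H, the
    i-th label of the f(h)-th row of q labels, counted upwards or downwards
    according to the colour of h in the balanced colouring. Every vertex of H
    has t neighbours of each colour, and the two colours are equally frequent,
    so the terms in i cancel: the weight of (x, h) depends only on the block of
    x and on w_f(h), which gives at most 3 chi_ld(H) weights. Two neighbourhood
    sums of f differ by less than n(n - 2t), since two 2t-sets differ in at most
    n - 2t places; this keeps the weights over the apex above those over A,
    and these above those over the other part. *)
Require Import Defs.
From mathcomp Require Import all_boot zify.

Set Implicit Arguments.
Unset Strict Implicit.
Unset Printing Implicit Defensive.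

(** * Label functions, double counting and sums over vertex sets *)

Section Labelings.
Variable G : sgraph.

Lemma labeling_of_inj (L : G -> nat) :
    injective L -> (forall u, 0 < L u <= #|G|) ->
  exists2 f : labeling G, is_bij f & label f =1 L.
Proof.
move=> injL ranL.
have lt u : (L u).-1 < #|G| by have := ranL u; lia.
pose f : labeling G := [ffun u => Ordinal (lt u)].
have labf : label f =1 L.
  by move=> u; rewrite /label ffunE /=; have := ranL u; lia.
have injf : injective f.
  by move=> u v fuv; apply: injL; rewrite -!labf /label fuv.
exists f => //; apply/andP; split; first exact/injectiveP.
by apply/forallP=> i; apply: inj_card_onto; rewrite ?card_ord.
Qed.

Lemma num_weights_le (f : labeling G) (s : seq nat) :
  (forall u, weight f u \in s) -> num_weights f <= size s.
Proof.
move=> sub; apply: uniq_leq_size; first exact: undup_uniq.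
by move=> w; rewrite mem_undup => /codomP[u ->].
Qed.

End Labelings.

(** Count the pairs [(a, b)] with [e a b] from either side. The sets serve both as the parts of a
    bipartition and as colour classes; in the latter case edges inside a class are simply not
    counted. *)
Lemma biregular_card (T : finType) (e : rel T) (A B : {set T}) (r : nat) :
    symmetric e -> 0 < r ->
    (forall a, a \in A -> #|[set b in B | e a b]| = r) ->
    (forall b, b \in B -> #|[set a in A | e b a]| = r) ->
  #|A| = #|B|.
Proof.
move=> e_sym r0 eA eB; apply/eqP; rewrite -(eqn_pmul2r r0) -!sum_nat_const.
rewrite -(eq_bigr _ eA) -(eq_bigr _ eB).
have E (C D : {set T}) : \sum_(a in C) #|[set b in D | e a b]| =
    \sum_(a in C) \sum_(b in D) e a b.
  apply: eq_bigr => a _; rewrite -sum1_card big_mkcond [RHS]big_mkcond.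
  by apply: eq_bigr => b _; rewrite inE; case: (b \in D); case: (e a b).
rewrite !E exchange_big /=; apply/eqP.
by apply: eq_bigr => b _; apply: eq_bigr => a _; rewrite e_sym.
Qed.

(** The terms on the intersection occur in both sums; the rest of [N'] lies outside [N], so it has
    at most [#|T| - #|N|] elements. *)
Lemma sum_exchange_bound (T : finType) (e : T -> nat) (b : nat)
    (N N' : {set T}) :
    (forall x, e x <= b) ->
  \sum_(x in N') e x <= \sum_(x in N) e x + (#|T| - #|N|) * b.
Proof.
move=> eb; rewrite (big_setID N) /=; apply: leq_add.
  by rewrite setIC [X in _ <= X](big_setID N') /= leq_addr.
apply: (@leq_trans (\sum_(x in N' :\: N) b)); first exact: leq_sum.
rewrite sum_nat_const leq_mul2r; apply/orP; right.
by rewrite -(cardsC N) addKn subset_leq_card // setDE subsetIr.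
Qed.

(* The term running up on one colour and down on the other makes the sum
   independent of the row i. *)
Lemma balanced_block_sum (T : finType) (S : {set T}) (c : T -> bool)
    (e : T -> nat) (o q i s : nat) :
    i < q -> #|[set x in S | c x]| = s -> #|[set x in S | ~~ c x]| = s ->
  \sum_(x in S) (o + e x * q + (if c x then i else q.-1 - i)).+1 =
    q * (\sum_(x in S) e x) + 2 * s * o.+1 + s * q.-1.
Proof.
move=> iq cS cS'.
have sum_on (D : {set T}) (j : nat) :
    \sum_(x in D) (o + e x * q + j).+1 =
      q * (\sum_(x in D) e x) + #|D| * (o + j).+1.
  rewrite big_distrr -sum_nat_const -big_split; apply: eq_bigr => x _ /=; lia.
have split_colour (F : T -> nat) : \sum_(x in S) F x =
    \sum_(x in [set x in S | c x]) F x +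
    \sum_(x in [set x in S | ~~ c x]) F x.
  by rewrite (bigID c); congr (_ + _); apply: eq_bigl => x; rewrite inE.
rewrite !split_colour.
rewrite (eq_bigr (fun x => (o + e x * q + i).+1)); last first.
  by move=> x; rewrite inE => /andP[_ ->].
rewrite [X in _ + X = _]
  (eq_bigr (fun x => (o + e x * q + (q.-1 - i)).+1)); last first.
  by move=> x; rewrite inE => /andP[_ /negbTE->].
rewrite !sum_on cS cS'; have -> : q.-1 = i + (q.-1 - i) by lia.
rewrite addKn; lia.
Qed.

(** * Neighbourhood sums in lexicographic products and joins *)

Section Products.
Variables J H : sgraph.

Lemma sum_nbhd_lexprod (F : J * H -> nat) (x : J) (h : H) :
  \sum_(y in nbhd ((x, h) : lexprod J H)) F y =
    \sum_(y in nbhd x) \sum_h' F (y, h') + \sum_(h' in nbhd h) F (x, h').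
Proof.
rewrite pair_big_dep /= (bigID (fun y => edge x y.1)) /=; congr (_ + _).
  apply: eq_big => [[y h']|[y h'] _] //.
  by rewrite !inE /= /lex_edge /=; case: edge; rewrite ?andbF.
rewrite (reindex_onto (pair x) snd) /=; last first.
  move=> [y h'] /=; rewrite !inE /= /lex_edge /=; case: edge => //=.
  by rewrite andbT => /andP[/eqP->].
apply: eq_bigl => h'.
by rewrite !inE /= /lex_edge /= edge_irr !eqxx /= !andbT.
Qed.

Lemma sum_nbhd_join_inl (F : J + H -> nat) (g : J) :
  \sum_(y in nbhd (inl g : join J H)) F y =
    \sum_(y in nbhd g) F (inl y) + \sum_h F (inr h).
Proof.
by rewrite big_sumType /=; congr (_ + _); apply: eq_bigl => y; rewrite !inE.
Qed.

Lemma sum_nbhd_join_inr (F : J + H -> nat) (h : H) :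
  \sum_(y in nbhd (inr h : join J H)) F y =
    \sum_g F (inl g) + \sum_(y in nbhd h) F (inr y).
Proof.
by rewrite big_sumType /=; congr (_ + _); apply: eq_bigl => y; rewrite !inE.
Qed.

End Products.

(* The parameters s, cA, cB, cK are the label sums of H (labels from 0) and of
   a copy over A, over the other part, and over the apex; u and v stand for
   neighbourhood sums in H with labels from 0. *)
Section WeightGaps.
Variables (n half t d k p s cA cB cK : nat).
Hypotheses (n_half : n = 2 * half) (n_split : n = 2 * t + d) (d_gt0 : 0 < d).
Hypotheses (k_gt0 : 0 < k) (k_le : k <= p).
Hypotheses (cAE : cA = p * s + n * n.+1 + half * p.-1)
  (cBE : cB = p * s + n * (n + p * n).+1 + half * p.-1)
  (cKE : cK = s + n).

(** As [cB - cA = p * n^2], the [k] copies over the opposite part give a lead of at least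
    [p * n^2 = p * (2 * t * n + d * n)]. The higher offset inside the own copy costs
    [2 * t * p * n], and the neighbourhood sums cost at most [p * d * n.-1]. *)
Lemma weight_gap_parts (u v : nat) : v <= u + d * n.-1 ->
  k * cA + cK + (p * v + 2 * t * (n + p * n).+1 + t * p.-1) <
  k * cB + cK + (p * u + 2 * t * n.+1 + t * p.-1).
Proof.
move=> uv.
have -> : cB = cA + n * (p * n) by lia.
have h : p * (v + 2 * t * n) < p * (u + k * (n * n)).
  rewrite ltn_pmul2l; last by lia.
  have : n * n <= k * (n * n) by rewrite leq_pmull.
  have : d * n.-1 < d * n by rewrite ltn_pmul2l //; lia.
  have : n * n = 2 * t * n + d * n by rewrite {1}n_split mulnDl.
  lia.
lia.
Qed.

(** The apex sees all copies over both parts: [p * cB] absorbs [k * cB], and [p * cA] exceeds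
    everything else. One of the [p] terms [v] is compared with [u], the other [p - 1] with [s]. *)
Lemma weight_gap_apex (u v : nat) : v <= u + d * n.-1 -> v <= s ->
  k * cB + cK + (p * v + 2 * t * n.+1 + t * p.-1) <
  p * cA + p * cB + (1 * u + 2 * t * 1 + t * 0).
Proof.
move=> uv vs.
have h1 : k * cB <= p * cB by rewrite leq_mul2r k_le orbT.
have [r pE] : exists r, p = r.+1 by exists p.-1; lia.
have h2 : d * n.-1 < d * n by rewrite ltn_pmul2l //; lia.
have h3 : n * n = 2 * t * n + d * n by rewrite {1}n_split mulnDl.
have h4 : r * v <= r * s by rewrite leq_mul2l vs orbT.
have h5 : r * t <= r * n by rewrite leq_mul2l; apply/orP; right; lia.
have h6 : p * v = v + r * v by rewrite pE mulSn.
have h7 : s + r * s <= p * (p * s).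
  by rewrite -mulSn -pE leq_pmull //; lia.
have h8 : n * n <= p * (n * n) by rewrite leq_pmull //; lia.
have h9 : p * n = n + r * n by rewrite pE mulSn.
have h10 : p * (p * s) + p * (n * n) + p * n <= p * cA.
  by rewrite cAE mulnS -!mulnDr leq_mul2l; apply/orP; right; lia.
have h11 : t * p.-1 = r * t by rewrite pE mulnC.
rewrite cKE h11 h6; lia.
Qed.

End WeightGaps.

Lemma mul_add_inj (q a b i j : nat) :
  i < q -> j < q -> a * q + i = b * q + j -> a = b /\ i = j.
Proof.
move=> iq jq E; have ab : a = b.
  have q0 : 0 < q by lia.
  have := congr1 (divn^~ q) E.
  by rewrite !divnMDl // !divn_small // !addn0.
by split=> //; move: E; rewrite ab => /addnI.
Qed.

(** * Degrees and parts of regular bipartite graphs *)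

Lemma regular_gt0 (G : sgraph) (k : nat) :
  no_isolated G -> regular G k -> G -> 0 < k.
Proof.
move=> noiso reg x; rewrite -(reg x) card_gt0; have [y xy] := noiso x.
by apply/set0Pn; exists y; rewrite inE.
Qed.

Lemma regular_lt_card (G : sgraph) (k : nat) : regular G k -> G -> k < #|G|.
Proof.
move=> reg x; rewrite -(reg x) -cardsT proper_card // properT.
by apply/eqP => /setP/(_ x); rewrite !inE edge_irr.
Qed.

Lemma regular_bipartite_le (G : sgraph) (k : nat) (A : {set G}) :
    regular G k -> (forall x y : G, edge x y -> (x \in A) != (y \in A)) ->
  forall x : G, k <= #|if x \in A then ~: A else A|.
Proof.
move=> reg bip x; rewrite -(reg x); apply/subset_leq_card/subsetP=> y.
rewrite inE => /bip; case: ifP => xA; first by rewrite inE.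
by case: (y \in A).
Qed.

Lemma bipartite_parts_card (G : sgraph) (k : nat) (A : {set G}) :
    no_isolated G -> regular G k ->
    (forall x y : G, edge x y -> (x \in A) != (y \in A)) ->
  #|A| = #|~: A|.
Proof.
move=> noiso reg bip; case: (pickP G) => [x0 _|G0]; last first.
  by rewrite !eq_card0 // => x; have := G0 x.
apply: (@biregular_card _ (@edge G) A (~: A) k) (regular_gt0 noiso reg x0) _ _.
- exact: edge_sym.
- move=> a aA; rewrite -(reg a); apply: eq_card => b; rewrite !inE.
  case: (boolP (edge a b)) => [/bip|]; rewrite ?andbF // aA andbT.
  by case: (b \in A).
move=> b; rewrite inE => /negbTE bA; rewrite -(reg b).
apply: eq_card => a; rewrite !inE.
case: (boolP (edge b a)) => [/bip|]; rewrite ?andbF // bA andbT.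
by case: (a \in A).
Qed.

(** * Colour classes of a balanced colouring *)

Section BalancedColouring.
Variables (H : sgraph) (t : nat) (c : H -> bool).
Hypotheses (H_noiso : no_isolated H) (H_reg : regular H (2 * t)).
Hypothesis c_bal : neighborhood_balanced c.

Lemma balanced_nbhd_card (h : H) :
  #|[set x in nbhd h | c x]| = t /\ #|[set x in nbhd h | ~~ c x]| = t.
Proof.
have : #|nbhd h| = #|[set x in nbhd h | c x]| + #|[set x in nbhd h | ~~ c x]|.
  rewrite -(cardsID [set x | c x] (nbhd h)).
  by congr addn; apply: eq_card => x; rewrite !inE // andbC.
by rewrite H_reg (c_bal h); lia.
Qed.

(** Every vertex, whatever its colour, has [t > 0] neighbours in each class, so double counting the
    edges between the classes makes them equal in size. *)
Lemma balanced_card :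
  #|[set h in [set: H] | c h]| = #|H|./2 /\
  #|[set h in [set: H] | ~~ c h]| = #|H|./2 /\ #|H| = 2 * #|H|./2.
Proof.
have HE : #|H| = #|[set h in [set: H] | c h]| + #|[set h in [set: H] | ~~ c h]|.
  rewrite -cardsT -(cardsID [set x | c x] [set: H]).
  by congr addn; apply: eq_card => x; rewrite !inE // andbC.
suff E : #|[set h in [set: H] | c h]| = #|[set h in [set: H] | ~~ c h]|.
  by rewrite HE E; lia.
case: (pickP H) => [h0 _|H0]; last first.
  by rewrite !eq_card0 // => x; have := H0 x.
have t_gt0 : 0 < t by have := regular_gt0 H_noiso H_reg h0; lia.
apply: (@biregular_card _ (@edge H) _ _ t _ t_gt0); first exact: edge_sym.
  move=> a _; rewrite -(balanced_nbhd_card a).2.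
  by apply: eq_card => b; rewrite !inE andbC.
move=> b _; rewrite -[RHS](balanced_nbhd_card b).1.
by apply: eq_card => a; rewrite !inE andbC.
Qed.

End BalancedColouring.

Theorem theorem6p7 (G H : sgraph) (k m t n : nat)
  (G_noiso : no_isolated G) (H_noiso : no_isolated H)
  (G_order : #|G| = m) (G_reg : regular G k) (G_bip : bipartite G)
  (H_order : #|H| = n) (H_reg : regular H (2 * t))
  (H_nbc : admits_nbc H) (H_ld : admits_ld_antimagic H) :
  admits_ld_antimagic (lexprod (join G K1) H) /\
  chi_ld (lexprod (join G K1) H) <= 3 * chi_ld H.
Proof.
have [f f_ld <-] := (chi_ldP H_ld).1.
have [c c_bal] := H_nbc; have [A A_bip] := G_bip.
have [/andP[/injectiveP f_inj _] /forallP f_prop] := andP f_ld.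
(* Labels are counted from 0 here; by regularity this lowers every weight by [2 * t]. *)
pose e (h : H) : nat := f h.
pose u (h : H) : nat := \sum_(x in nbhd h) e x.
have e_inj : injective e by move=> x y /val_inj/f_inj.
have e_lt h : e h < n by rewrite -H_order ltn_ord.
have weightE h : weight f h = u h + 2 * t.
  rewrite /weight /label -(H_reg h) -sum1_card -big_split /=.
  by apply: eq_bigr => x _; rewrite addn1.
have u_neq h h' : edge h h' -> u h != u h'.
  move=> hh'; have /forallP/(_ h')/implyP/(_ hh') := f_prop h.
  by rewrite !weightE eqn_add2r.
have nbhd_c := balanced_nbhd_card H_reg c_bal.
have [R1 [R0 nE]] := balanced_card H_noiso H_reg c_bal.
have u_gap h h' : u h' <= u h + (n - 2 * t) * n.-1.
  rewrite -(H_reg h) -H_order; apply: sum_exchange_bound => x.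
  by have := e_lt x; lia.
pose half := n./2; rewrite H_order -/half in R1 R0 nE.
pose s := \sum_h e h.
have u_le h : u h <= s by rewrite /s (bigID (mem (nbhd h))) leq_addr.
have pA : #|A| = #|~: A| := bipartite_parts_card G_noiso G_reg A_bip.
pose p := #|A|.
have mE : m = 2 * p by rewrite -G_order -(cardsC A) -pA /p; lia.
have n_gt (h : H) : 2 * t < n by rewrite -H_order (regular_lt_card H_reg h).
have k_le (g : G) : k <= p.
  by have := regular_bipartite_le G_reg A_bip g; case: ifP; rewrite -?pA.
(* [off x] is the last label before the block of [x], and [wid x] the number of copies in that
   block. [row x] is the position of the copy over [x] among them; the row of labels itself is
   indexed by [e h]. *)
pose off (x : join G K1) :=
  if x is inl g then if g \in A then n else n + p * n else 0.
pose wid (x : join G K1) := if x is inl _ then p else 1.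
pose row (x : join G K1) :=
  if x is inl g then index g (enum (if g \in A then A else ~: A)) else 0.
pose L (y : join G K1 * H) := (off y.1 + e y.2 * wid y.1 +
  (if c y.2 then row y.1 else (wid y.1).-1 - row y.1)).+1.
have row_lt x : row x < wid x.
  case: x => [g|] //=.
  rewrite [p](_ : _ = size (enum (if g \in A then A else ~: A))).
    by rewrite index_mem mem_enum; case: ifP => // gA; rewrite inE gA.
  by rewrite -cardE; case: ifP.
have L_range y : off y.1 < L y <= off y.1 + wid y.1 * n.
  case: y => x h; rewrite /L /= -addnA -addnS.
  have : (e h).+1 * wid x <= n * wid x by rewrite leq_mul2r e_lt orbT.
  have := row_lt x; rewrite mulSn; case: (c h); lia.
(* The range of a label reveals its block; division by the width then recovers [e h], hence [h] and
   its colour, and so the position of the copy. *)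
have L_inj : injective L.
  move=> [x h] [x' h'] E.
  have := L_range (x, h); have := L_range (x', h'); rewrite -E /= => r1 r2.
  have [offE widE] : off x = off x' /\ wid x = wid x'.
    by case: x x' r1 r2 {E} => [g|[]] [g'|[]] //=; do ?case: ifP; lia.
  move: E; rewrite /L /= offE widE -!addnA => -[] /addnI E.
  have := row_lt x; have := row_lt x'; rewrite widE => l1 l2.
  have [/e_inj hh rr] : e h = e h' /\ (if c h then row x else (wid x').-1 - row x) =
      if c h' then row x' else (wid x').-1 - row x'.
    by apply: mul_add_inj E; case: ifP; lia.
  rewrite -hh in rr *; congr (_, _).
  have {}rr : row x = row x' by move: rr; case: ifP; lia.
  case: x x' rr {r1 r2 widE l1 l2 E} offE => [g|[]] [g'|[]] //=; last first.
  - by case: ifP; have := e_lt h; lia.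
  - by case: ifP; have := e_lt h; lia.
  move=> rr offE; have AA : (g \in A) = (g' \in A).
    have pgt : 0 < p by have := row_lt (inl g); rewrite /=; lia.
    have pn : 0 < p * n by rewrite muln_gt0 pgt; have := e_lt h; lia.
    by move: offE; do 2!case: ifP => //; lia.
  congr inl; move: rr; rewrite AA => rr.
  have inE' z : (z \in A) = (g' \in A) -> z \in enum (if g' \in A then A else ~: A).
    by rewrite mem_enum => <-; case: ifP => // zA; rewrite inE zA.
  by rewrite -(nth_index g (inE' g AA)) rr nth_index ?inE'.
have LP (y : lexprod (join G K1) H) : 0 < L y <= #|lexprod (join G K1) H|.
  have -> : #|lexprod (join G K1) H| = n + p * n + p * n.
    by rewrite card_prod card_sum card_unit H_order G_order mE; lia.
  by have := L_range y; case: y => [[g|[]] h] /=; try case: ifP; lia.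
have [F F_bij F_lab] := @labeling_of_inj (lexprod (join G K1) H) L L_inj LP.
pose copy x := \sum_h L (x, h).
pose cK := s + n.
pose cA := p * s + n * n.+1 + half * p.-1.
pose cB := p * s + n * (n + p * n).+1 + half * p.-1.
have copyE x : copy x = wid x * s + 2 * half * (off x).+1 + half * (wid x).-1.
  rewrite (_ : s = \sum_(h in [set: H]) e h); last first.
    by apply: eq_bigl => h; rewrite inE.
  rewrite -(balanced_block_sum _ _ (row_lt x) R1 R0).
  by rewrite /copy /L; apply: eq_bigl => h; rewrite inE.
(* The contribution of the neighbouring copies: [k] over the opposite part and the apex copy, or,
   for the apex, all copies over G. *)
pose base (x : join G K1) :=
  if x is inl g then if g \in A then k * cB + cK else k * cA + cK
  else p * cA + p * cB.
have copy_inl g : copy (inl g) = if g \in A then cA else cB.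
  by rewrite copyE /= -nE; case: ifP.
have copy_inr : copy (inr tt) = cK by rewrite copyE /= -nE /cK; lia.
have baseE x : \sum_(y in nbhd x) copy y = base x.
  case: x => [g|[]]; rewrite ?sum_nbhd_join_inl ?sum_nbhd_join_inr /=.
    rewrite [X in _ + X](big_pred1 tt) => [|[]//]; rewrite copy_inr -(G_reg g).
    rewrite (eq_bigr (fun=> if g \in A then cB else cA)).
      by rewrite sum_nat_const; case: ifP.
    move=> y; rewrite inE => /A_bip; rewrite copy_inl.
    by case: (g \in A); case: (y \in A).
  rewrite [X in _ + X]big_pred0 ?addn0; last by move=> y; rewrite inE.
  rewrite (bigID (mem A)) /=; congr (_ + _).
    rewrite (eq_bigr (fun=> cA)) ?sum_nat_const // => g gA.
    by rewrite copy_inl gA.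
  rewrite (eq_bigr (fun=> cB)) => [|g /negbTE gA]; last by rewrite copy_inl gA.
  rewrite sum_nat_const /p pA; congr (_ * _).
  by apply: eq_card => g; rewrite !inE.
pose cls (x : join G K1) := if x is inl g then Some (g \in A) else None.
pose phi cl v := match cl with
  | None => p * cA + p * cB + (1 * v + 2 * t * 1 + t * 0)
  | Some true => k * cB + cK + (p * v + 2 * t * n.+1 + t * p.-1)
  | Some false => k * cA + cK + (p * v + 2 * t * (n + p * n).+1 + t * p.-1)
  end.
have wF x h : weight F (x, h) = phi (cls x) (u h).
  rewrite /weight (eq_bigr _ (fun y _ => F_lab y)) sum_nbhd_lexprod /=.
  have [c1 c0] := nbhd_c h.
  rewrite [X in _ + X](balanced_block_sum _ _ (row_lt x) c1 c0).
  rewrite [X in X + _](baseE x) /phi.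
  by case: x => [g|[]] //=; case: ifP.
(* A vertex [g] is required to get [0 < k] and [k <= p]; if G is empty, only the apex block
   occurs. *)
have phi_lt (g : G) h h' : phi (Some false) (u h) < phi (Some true) (u h') /\
    phi (Some true) (u h) < phi None (u h').
  have k_gt0 := regular_gt0 G_noiso G_reg g.
  have [n2 d0] : n = 2 * t + (n - 2 * t) /\ 0 < n - 2 * t by have := n_gt h; lia.
  split; [apply: (weight_gap_parts nE n2 d0 k_gt0 (k_le g)) |
          apply: (weight_gap_apex nE n2 d0 k_gt0 (k_le g))] => //; exact: u_gap.
have F_ld : is_ld_antimagic F.
  rewrite /is_ld_antimagic F_bij; apply/forallP=> -[x h]; apply/forallP=> -[x' h'].
  (* An edge of the join always links two different blocks, which [phi_lt] separates; inside a copy,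
     [u_neq] separates adjacent vertices. *)
  apply/implyP; rewrite !wF /edge /= /lex_edge /= => /orP[xx'|/andP[/eqP<- hh']].
    case: x x' xx' => [g|[]] [g'|[]] //=.
    - have [l1 _] := phi_lt g h h'; have [l2 _] := phi_lt g h' h.
      move=> /A_bip; case: (g \in A); case: (g' \in A) => // _.
        by rewrite neq_ltn l2 orbT.
      by rewrite neq_ltn l1.
    - have [l1 _] := phi_lt g h h'; have [_ l2] := phi_lt g h' h'.
      have [_ l3] := phi_lt g h h'.
      by case: (g \in A) => _; rewrite neq_ltn ?l3 // (ltn_trans l1 l2).
    - have [l1 _] := phi_lt g' h' h; have [_ l2] := phi_lt g' h h.
      have [_ l3] := phi_lt g' h' h.
      by case: (g' \in A) => _; rewrite neq_ltn ?l3 ?(ltn_trans l1 l2) orbT.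
  have := u_neq _ _ hh'; have := row_lt x.
  case: x => [g|[]] /= p0; last by rewrite /phi; lia.
  by case: (g \in A); rewrite /phi !eqn_add2l !eqn_add2r eqn_pmul2l //; lia.
split; first by exists F.
apply: leq_trans ((chi_ldP (ex_intro _ F F_ld)).2 _ F_ld) _.
(* Three blocks times the weights of the optimal [f]; subtracting [2 * t] turns such a weight back
   into a value of [u]. *)
pose ws := undup (codom (weight f)).
pose vals :=
  [seq phi cl (w - 2 * t) | cl <- [:: None; Some true; Some false], w <- ws].
rewrite (_ : 3 * _ = size vals); last by rewrite size_allpairs.
apply: num_weights_le => -[x h]; rewrite wF; apply/allpairsP.
exists (cls x, weight f h); split => /=.
- by case: x => [g|] //=; case: (g \in A).
- by rewrite mem_undup codom_f.
- by rewrite weightE addnK.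
Qed.
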